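(* Girard's call-by-value translation $(\cdot)^{*}$ is a simplification from outside of the outer full Girard translation $(\cdot)^{{\rm Gf}_o}$ (as translations from $\mathsf{IL}_{\rm b}$ to $\mathsf{ILL}$): for any formula $A$ of the language of $\mathsf{ILL}$, one obtains $A^{*}$ from $A^{{\rm Gf}_o}$ by systematically applying the following formula reductions, starting from the whole formula and inductively applying them to the subformulas: $$!(!A\otimes\,!B)\mapsto\,!A\otimes\,!B,\qquad !(!A\oplus\,!B)\mapsto\,!A\oplus\,!B,\qquad !\exists x\,!A\mapsto\exists x\,!A,\qquad !!!A\mapsto\,!!A.$$ Moreover, the reductions above are reversible in $\mathsf{ILL}$ (i.e. the two sides of each reduction are provably equivalent in $\mathsf{ILL}$).
   Context: Intuitionistic linear logic $\mathsf{ILL}$ (first order). Formulas are built from atomic formulas, including the constants $1,\top,0$, using $\otimes,\&,\oplus,\multimap$, $\forall x,\exists x$ and $!$. Sequents are $\Gamma\vdash A$ with $\Gamma$ a finite multiset of formulas and exactly one formula on the right. Axioms: $A\vdash A$; $\vdash 1$; $\Gamma\vdash\top$; $\Gamma,0\vdash C$. Rules (premises $\Rightarrow$ conclusion): (cut) $\Gamma\vdash A;\ \Delta,A\vdash C\Rightarrow\Gamma,\Delta\vdash C$; $\Gamma\vdash C\Rightarrow\Gamma,1\vdash C$; $\Gamma\vdash A;\ \Delta\vdash B\Rightarrow\Gamma,\Delta\vdash A\otimes B$; $\Gamma,A,B\vdash C\Rightarrow\Gamma,A\otimes B\vdash C$; $\Gamma,A\vdash B\Rightarrow\Gamma\vdash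 A\multimap B$; $\Gamma\vdash A;\ \Delta,B\vdash C\Rightarrow\Gamma,\Delta,A\multimap B\vdash C$; $\Gamma\vdash A;\ \Gamma\vdash B\Rightarrow\Gamma\vdash A\& B$; $\Gamma,A\vdash C\Rightarrow\Gamma,A\& B\vdash C$; $\Gamma,B\vdash C\Rightarrow\Gamma,A\& B\vdash C$; $\Gamma\vdash A\Rightarrow\Gamma\vdash A\oplus B$; $\Gamma\vdash B\Rightarrow\Gamma\vdash A\oplus B$; $\Gamma,A\vdash C;\ \Gamma,B\vdash C\Rightarrow\Gamma,A\oplus B\vdash C$; $\Gamma\vdash A\Rightarrow\Gamma\vdash\forall xA$; $\Gamma,A[t/x]\vdash C\Rightarrow\Gamma,\forall xA\vdash C$; $\Gamma\vdash A[t/x]\Rightarrow\Gamma\vdash\exists xA$; $\Gamma,A\vdash C\Rightarrow\Gamma,\exists xA\vdash C$ (usual eigenvariable conditions); $\Gamma,!A,!A\vdash C\Rightarrow\Gamma,!A\vdash C$; $\Gamma\vdash C\Rightarrow\Gamma,!A\vdash C$; $!\Gamma\vdash A\Rightarrow\,!\Gamma\vdash\,!A$; $\Gamma,A\vdash C\Rightarrow\Gamma,!A\vdash C$. $\mathsf{PRO}$ is the axiom schema $A\vdash\,!A$; $\mathsf{IL}_{\rm b}:=\mathsf{ILL}+\mathsf{PRO}$. Formulas $A,B$ are equivalent over $S$ if $S$ proves $(A\multimap B)\&(B\multimap A)$. Translations. Throughout $\square\in\{\otimes,\&,\oplus,\multimap\}$, $Q\in\{\forall x,\exists x,!\}$.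 Outer full Girard: $P^{{\rm Gf}_o}:=\,!P$ ($P$ atomic), $(A\,\square\,B)^{{\rm Gf}_o}:=\,!(A^{{\rm Gf}_o}\,\square\,B^{{\rm Gf}_o})$, $(QA)^{{\rm Gf}_o}:=\,!QA^{{\rm Gf}_o}$. Call-by-value: $P^*:=\,!P$ ($P$ atomic); $(A\otimes B)^*:=A^*\otimes B^*$; $(A\& B)^*:=\,!(A^*\& B^* )$; $(A\oplus B)^*:=A^*\oplus B^*$; $(A\multimap B)^*:=\,!(A^*\multimap B^* )$; $(\forall xA)^*:=\,!\forall xA^*$; $(\exists xA)^*:=\exists xA^*$; $(!A)^*:=\,!A^*$. General notions, for a formula construct $T$ (here $T(A)=\,!A$). A $T$-based outer-transform is $\mathcal T_\square(A,B)=T'(A\,\square\,B)$, resp. $\mathcal T_Q(A)=T'(QA)$, with $T'\in\{T,\mathrm{Id}\}$. A modular outer $T$-translation is one given by outer-transforms via $P^{\rm Tr}:=T(P)$ ($P$ atomic), $(A\,\square\,B)^{\rm Tr}:=\mathcal T^{\rm Tr}_\square(A^{\rm Tr},B^{\rm Tr})$, $(QA)^{\rm Tr}:=\mathcal T^{\rm Tr}_Q(A^{\rm Tr})$. A transform is simpler than another one for the same connective, quantifier or modality if the latter uses $T$ in all places where the former does, but not conversely. A translation is sound from $S_1$ to $S_2$ if for all $A$: $\vdash_{S_1}A$ implies $\vdash_{S_2}A^{\rm Tr}$, and $A$, $A^{\rm Tr}$ are equivalent over $S_1$. Two sound translations from $S_1$ to $S_2$ are equivalent if $A^{\rm Tr}$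 and $A^{{\rm Tr}'}$ are equivalent over $S_2$ for all $A$. For equivalent translations, ${\rm Tr}'$ is a simplification of ${\rm Tr}$ if each transform of ${\rm Tr}'$ is identical to or simpler than the corresponding one of ${\rm Tr}$, and simpler in at least one case. For two equivalent modular outer $T$-translations, ${\rm Tr}'$ is a simplification from outside of ${\rm Tr}$ if it is a simplification of ${\rm Tr}$ and $A^{{\rm Tr}'}$ is obtained from $A^{\rm Tr}$ by applying the reductions $\mathcal T^{\rm Tr}_\square(T(A),T(B))\mapsto\mathcal T^{{\rm Tr}'}_\square(T(A),T(B))$ and $\mathcal T^{\rm Tr}_Q(T(A))\mapsto\mathcal T^{{\rm Tr}'}_Q(T(A))$ recursively, starting from the whole formula and working towards the atomic formulas (at each stage the reduction matching the current formula, if there is one, is applied to it, and one then continues with the parts $T(A)$, $T(B)$ that are the translations of the immediate subformulas). *)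

(* Defs.v *)
From Stdlib Require Vector.
From Stdlib Require Import List Permutation.
Import ListNotations.

Set Implicit Arguments.
Unset Strict Implicit.

(** First-order syntax is in de Bruijn style: variable [0] is
    bound by the innermost quantifier, so quantifiers carry no name. *)

Record signature : Type := Signature {
  fun_sym : Type;
  fun_ar : fun_sym -> nat;
  rel_sym : Type;
  rel_ar : rel_sym -> nat
}.

Section Syntax.

Variable Sg : signature.

Inductive term : Type :=
| Var : nat -> term
| Fun : forall f : fun_sym Sg, Vector.t term (fun_ar f) -> term.

Inductive atom : Type :=
| Rel : forall p : rel_sym Sg, Vector.t term (rel_ar p) -> atom
| One : atom
| Top : atom
| Zero : atom.

Inductive binop : Type := Tensor | With | Plus | Lolli.

Inductive unop : Type := Forall | Exists | Bang.

Inductive formula : Type :=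
| At : atom -> formula
| Bin : binop -> formula -> formula -> formula
| Un : unop -> formula -> formula.

Fixpoint subst_term (s : nat -> term) (t : term) : term :=
  match t with
  | Var n => s n
  | Fun ts => Fun (Vector.map (subst_term s) ts)
  end.

Definition subst_atom (s : nat -> term) (a : atom) : atom :=
  match a with
  | Rel ts => Rel (Vector.map (subst_term s) ts)
  | One => One
  | Top => Top
  | Zero => Zero
  end.

Definition shift_term : term -> term := subst_term (fun n => Var (S n)).

Definition up (s : nat -> term) : nat -> term :=
  fun n => match n with
           | 0 => Var 0
           | S m => shift_term (s m)
           end.

Fixpoint subst (s : nat -> term) (A : formula) : formula :=
  match A with
  | At a => At (subst_atom s a)
  | Bin c B C => Bin c (subst s B) (subst s C)
  | Un Bang B => Un Bang (subst s B)
  | Un q B => Un q (subst (up s) B)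
  end.

Definition shift : formula -> formula := subst (fun n => Var (S n)).

(** [inst t A] is A[t/x], where [x] is variable [0] of [A]; the remaining
    variables are lowered by one. *)
Definition inst (t : term) : formula -> formula :=
  subst (fun n => match n with 0 => t | S m => Var m end).

End Syntax.

Arguments Var {Sg} _.
Arguments One {Sg}.
Arguments Top {Sg}.
Arguments Zero {Sg}.

Declare Scope ill_scope.
Delimit Scope ill_scope with ill.
Bind Scope ill_scope with formula.

Notation one := (At One).
Notation top := (At Top).
Notation zero := (At Zero).
Notation bang := (Un Bang).
Notation all := (Un Forall).
Notation ex := (Un Exists).
Notation "A ⊗ B" := (Bin Tensor A B) (at level 40, left associativity) : ill_scope.
Notation "A & B" := (Bin With A B) (at level 40, left associativity) : ill_scope.
Notation "A ⊕ B" := (Bin Plus A B) (at level 50, left associativity) : ill_scope.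
Notation "A ⊸ B" := (Bin Lolli A B) (at level 55, right associativity) : ill_scope.

Local Open Scope ill_scope.

Section Calculus.

Variable Sg : signature.

Local Notation formula := (formula Sg).

Definition system : Type := list formula -> formula -> Prop.

(** Derivability in intuitionistic linear logic extended by the axiom sequents
    [Ax]. Contexts are multisets, i.e. lists up to [d_exchange]. The
    eigenvariable conditions of [d_all_r] and [d_ex_l] are expressed by shifting
    the side formulas, so that variable [0] does not occur free in them. *)
Inductive derivable (Ax : system) : system :=
| d_ax : forall G C, Ax G C -> derivable Ax G C
| d_exchange : forall G D C,
    Permutation G D -> derivable Ax G C -> derivable Ax D C
| d_id : forall A, derivable Ax [A] A
| d_one_r : derivable Ax [] one
| d_top_r : forall G, derivable Ax G top
| d_zero_l : forall G C, derivable Ax (zero :: G) C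
| d_cut : forall G D A C,
    derivable Ax G A -> derivable Ax (A :: D) C -> derivable Ax (G ++ D) C
| d_one_l : forall G C, derivable Ax G C -> derivable Ax (one :: G) C
| d_tensor_r : forall G D A B,
    derivable Ax G A -> derivable Ax D B -> derivable Ax (G ++ D) (A ⊗ B)
| d_tensor_l : forall G A B C,
    derivable Ax (A :: B :: G) C -> derivable Ax (A ⊗ B :: G) C
| d_lolli_r : forall G A B,
    derivable Ax (A :: G) B -> derivable Ax G (A ⊸ B)
| d_lolli_l : forall G D A B C,
    derivable Ax G A -> derivable Ax (B :: D) C ->
    derivable Ax ((A ⊸ B) :: G ++ D) C
| d_with_r : forall G A B,
    derivable Ax G A -> derivable Ax G B -> derivable Ax G (A & B)
| d_with_l1 : forall G A B C,
    derivable Ax (A :: G) C -> derivable Ax (A & B :: G) C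
| d_with_l2 : forall G A B C,
    derivable Ax (B :: G) C -> derivable Ax (A & B :: G) C
| d_plus_r1 : forall G A B, derivable Ax G A -> derivable Ax G (A ⊕ B)
| d_plus_r2 : forall G A B, derivable Ax G B -> derivable Ax G (A ⊕ B)
| d_plus_l : forall G A B C,
    derivable Ax (A :: G) C -> derivable Ax (B :: G) C ->
    derivable Ax (A ⊕ B :: G) C
| d_all_r : forall G A,
    derivable Ax (map (@shift Sg) G) A -> derivable Ax G (all A)
| d_all_l : forall G A t C,
    derivable Ax (inst t A :: G) C -> derivable Ax (all A :: G) C
| d_ex_r : forall G A t,
    derivable Ax G (inst t A) -> derivable Ax G (ex A)
| d_ex_l : forall G A C,
    derivable Ax (A :: map (@shift Sg) G) (shift C) ->
    derivable Ax (ex A :: G) C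
| d_contraction : forall G A C,
    derivable Ax (bang A :: bang A :: G) C -> derivable Ax (bang A :: G) C
| d_weakening : forall G A C, derivable Ax G C -> derivable Ax (bang A :: G) C
| d_promotion : forall G A,
    derivable Ax (map bang G) A -> derivable Ax (map bang G) (bang A)
| d_dereliction : forall G A C,
    derivable Ax (A :: G) C -> derivable Ax (bang A :: G) C.

Definition ILL : system := derivable (fun _ _ => False).

Inductive PRO : system :=
| pro : forall A, PRO [A] (bang A).

Definition ILb : system := derivable PRO.

Definition proves (S : system) (A : formula) : Prop := S [] A.

Definition equivalent (S : system) (A B : formula) : Prop :=
  proves S ((A ⊸ B) & (B ⊸ A)).

End Calculus.

Section Translations.

Variable Sg : signature.

Local Notation formula := (formula Sg).
Local Notation system := (system Sg).

Definition sound (S1 S2 : system) (tr : formula -> formula) : Prop :=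
  (forall A, proves S1 A -> proves S2 (tr A)) /\
  (forall A, equivalent S1 A (tr A)).

Definition equivalent_translations (S1 S2 : system) (tr tr' : formula -> formula)
    : Prop :=
  sound S1 S2 tr /\ sound S1 S2 tr' /\
  forall A, equivalent S2 (tr A) (tr' A).

(** A choice of outer-transforms for a formula construct [T]: the boolean is
    [true] when T' = T and [false] when T' = Id. *)
Record outer_transforms : Type := OuterTransforms {
  uses_bin : binop -> bool;
  uses_un : unop -> bool
}.

Definition bin_transform (T : formula -> formula) (M : outer_transforms)
    (c : binop) (A B : formula) : formula :=
  if uses_bin M c then T (Bin c A B) else Bin c A B.

Definition un_transform (T : formula -> formula) (M : outer_transforms)
    (q : unop) (A : formula) : formula :=
  if uses_un M q then T (Un q A) else Un q A.

Definition modular_outer (T : formula -> formula) (M : outer_transforms)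
    (tr : formula -> formula) : Prop :=
  (forall a, tr (At a) = T (At a)) /\
  (forall c A B, tr (Bin c A B) = bin_transform T M c (tr A) (tr B)) /\
  (forall q A, tr (Un q A) = un_transform T M q (tr A)).

(** An outer-transform has a single place where [T] may be used. *)
Definition simpler (u' u : bool) : Prop :=
  (u' = true -> u = true) /\ ~ (u = true -> u' = true).

Definition identical_or_simpler (u' u : bool) : Prop := u' = u \/ simpler u' u.

(** [tr'], given by [M'], is a simplification of [tr], given by [M]. *)
Definition simplification (S1 S2 : system)
    (M' : outer_transforms) (tr' : formula -> formula)
    (M : outer_transforms) (tr : formula -> formula) : Prop :=
  equivalent_translations S1 S2 tr tr' /\
  (forall c, identical_or_simpler (uses_bin M' c) (uses_bin M c)) /\
  (forall q, identical_or_simpler (uses_un M' q) (uses_un M q)) /\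
  ((exists c, simpler (uses_bin M' c) (uses_bin M c)) \/
   (exists q, simpler (uses_un M' q) (uses_un M q))).

Inductive transform_reduction (T : formula -> formula) (M M' : outer_transforms)
    : formula -> formula -> Prop :=
| tred_bin : forall c A B,
    transform_reduction T M M'
      (bin_transform T M c (T A) (T B)) (bin_transform T M' c (T A) (T B))
| tred_un : forall q A,
    transform_reduction T M M'
      (un_transform T M q (T A)) (un_transform T M' q (T A)).

(** [reduces_outside T M M' X Y]: [Y] results from [X] by the reductions
    [transform_reduction T M M'], applied first to [X] itself and then to the
    parts [T A], [T B] displayed in the redex. The original formula whose
    translation is [X] plays no role in it. *)
Inductive reduces_outside (T : formula -> formula) (M M' : outer_transforms)
    : formula -> formula -> Prop :=
| ro_bin : forall c A B A' B',
    reduces_outside T M M' (T A) A' ->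
    reduces_outside T M M' (T B) B' ->
    reduces_outside T M M'
      (bin_transform T M c (T A) (T B)) (bin_transform T M' c A' B')
| ro_un : forall q A A',
    reduces_outside T M M' (T A) A' ->
    reduces_outside T M M' (un_transform T M q (T A)) (un_transform T M' q A')
| ro_stop : forall X,
    (forall Y, ~ transform_reduction T M M' X Y) ->
    reduces_outside T M M' X X.

Definition simplification_from_outside (T : formula -> formula)
    (S1 S2 : system) (tr' tr : formula -> formula) : Prop :=
  exists M' M : outer_transforms,
    modular_outer T M' tr' /\ modular_outer T M tr /\
    simplification S1 S2 M' tr' M tr /\
    forall A, reduces_outside T M M' (tr A) (tr' A).

Fixpoint Gfo (A : formula) : formula :=
  match A with
  | At a => bang (At a)
  | Bin c B C => bang (Bin c (Gfo B) (Gfo C))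
  | Un q B => bang (Un q (Gfo B))
  end.

Fixpoint cbv (A : formula) : formula :=
  match A with
  | At a => bang (At a)
  | B ⊗ C => cbv B ⊗ cbv C
  | B & C => bang (cbv B & cbv C)
  | B ⊕ C => cbv B ⊕ cbv C
  | B ⊸ C => bang (cbv B ⊸ cbv C)
  | Un Forall B => bang (all (cbv B))
  | Un Exists B => ex (cbv B)
  | Un Bang B => bang (cbv B)
  end.

Inductive girard_reduction : formula -> formula -> Prop :=
| gr_tensor : forall A B,
    girard_reduction (bang (bang A ⊗ bang B)) (bang A ⊗ bang B)
| gr_plus : forall A B,
    girard_reduction (bang (bang A ⊕ bang B)) (bang A ⊕ bang B)
| gr_ex : forall A,
    girard_reduction (bang (ex (bang A))) (ex (bang A))
| gr_bang : forall A,
    girard_reduction (bang (bang (bang A))) (bang (bang A)).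

(** One pass from the outside: at each formula the matching reduction, if any,
    is applied once, and the pass goes on with the immediate subformulas of the
    result. *)
Inductive outside_pass (R : formula -> formula -> Prop)
    : formula -> formula -> Prop :=
| op_reduce : forall X Y Z,
    R X Y -> subformulas_pass R Y Z -> outside_pass R X Z
| op_skip : forall X Z,
    (forall Y, ~ R X Y) -> subformulas_pass R X Z -> outside_pass R X Z
with subformulas_pass (R : formula -> formula -> Prop)
    : formula -> formula -> Prop :=
| sp_at : forall a, subformulas_pass R (At a) (At a)
| sp_bin : forall c A B A' B',
    outside_pass R A A' -> outside_pass R B B' ->
    subformulas_pass R (Bin c A B) (Bin c A' B')
| sp_un : forall q A A',
    outside_pass R A A' -> subformulas_pass R (Un q A) (Un q A').

End Translations.

(* Main.v *)
From Stdlib Require Import List Permutation.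
Require Import Defs.
Import ListNotations.

(** Call a formula storable when [A ⊢ !A]. Formulas [!A] are storable, and
    [⊗], [⊕], [∃] preserve storability in [ILL]; this is what makes each of the
    four reductions reversible, and it makes every [cbv A] storable. Hence a
    context of call-by-value translations behaves like a banged one, so that [cbv]
    interprets [ILb] in [ILL], with [PRO] interpreted by storability itself.
    Congruence of the connectives yields that [cbv A] and [Gfo A] are equivalent
    over [ILL], and [A] and [cbv A] over [ILb]; all facts about [Gfo] follow from
    those about [cbv]. *)

Set Implicit Arguments.
Unset Strict Implicit.

Local Open Scope ill_scope.

(** * Renamings undone by substitution, and substitution under [cbv] *)

Section Substitution.

Variable Sg : signature.

Lemma subst_term_rename_cancel (s u : nat -> term Sg) (r : nat -> nat) :
  (forall n, u n = Var (r n)) -> (forall n, s (r n) = Var n) ->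
  forall t, subst_term s (subst_term u t) = t.
Proof.
  (* Terms nest vectors of terms, so the recursion on terms is explicit and an inner induction
     handles the arguments. *)
  intros Hu Hs; fix IH 1; intros [n | f ts]; simpl.
  - rewrite Hu; apply Hs.
  - f_equal; induction ts as [| t k ts IHts]; simpl.
    + reflexivity.
    + f_equal; [apply IH | exact IHts].
Qed.

Lemma subst_atom_rename_cancel (s u : nat -> term Sg) (r : nat -> nat) :
  (forall n, u n = Var (r n)) -> (forall n, s (r n) = Var n) ->
  forall a, subst_atom s (subst_atom u a) = a.
Proof.
  intros Hu Hs [p ts | | |]; simpl; try reflexivity.
  f_equal; induction ts as [| t k ts IHts]; simpl.
  - reflexivity.
  - f_equal; [exact (subst_term_rename_cancel Hu Hs t) | exact IHts].
Qed.

(** Pointwise hypotheses avoid functional extensionality. The maps are quantified after [A] because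
    each binder lifts them, [r] becoming the [r'] below. *)
Lemma subst_rename_cancel (A : formula Sg) :
  forall (s u : nat -> term Sg) (r : nat -> nat),
  (forall n, u n = Var (r n)) -> (forall n, s (r n) = Var n) ->
  subst s (subst u A) = A.
Proof.
  assert (Hup : forall (s u : nat -> term Sg) (r : nat -> nat),
    (forall n, u n = Var (r n)) -> (forall n, s (r n) = Var n) ->
    let r' n := match n with 0 => 0 | S m => S (r m) end in
    (forall n, up u n = Var (r' n)) /\ (forall n, up s (r' n) = Var n)).
  { intros s u r Hu Hs; split; intros [| n]; simpl; try reflexivity.
    - rewrite Hu; reflexivity.
    - rewrite Hs; reflexivity. }
  induction A as [a | c A IHA B IHB | q A IHA]; intros s u r Hu Hs; simpl.
  - f_equal; exact (subst_atom_rename_cancel Hu Hs a).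
  - rewrite (IHA s u r Hu Hs), (IHB s u r Hu Hs); reflexivity.
  - destruct (Hup s u r Hu Hs) as [Hu' Hs'].
    destruct q; simpl; f_equal.
    + exact (IHA _ _ _ Hu' Hs').
    + exact (IHA _ _ _ Hu' Hs').
    + exact (IHA s u r Hu Hs).
Qed.

(** Lets the eigenvariable serve as its own witness once the quantified formula has been shifted. *)
Lemma inst_Var0_subst_up_shift (A : formula Sg) :
  inst (Var 0) (subst (up (fun n => Var (S n))) A) = A.
Proof.
  apply subst_rename_cancel with (r := fun n => match n with 0 => 0 | S m => S (S m) end);
    intros [| n]; reflexivity.
Qed.

Lemma cbv_subst (A : formula Sg) :
  forall s, cbv (subst s A) = subst s (cbv A).
Proof.
  induction A as [a | [] A IHA B IHB | [] A IHA]; intro s; simpl;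
    rewrite ?IHA, ?IHB; reflexivity.
Qed.

Lemma map_cbv_shift (G : list (formula Sg)) :
  map (@cbv Sg) (map (@shift Sg) G) = map (@shift Sg) (map (@cbv Sg) G).
Proof.
  rewrite !map_map; apply map_ext; intro A; apply cbv_subst.
Qed.

End Substitution.

(** * Storable formulas and congruence, over arbitrary axiom sequents *)

Section Derivations.

Variable Sg : signature.
Variable Ax : system Sg.

Local Notation formula := (formula Sg).
Local Notation "G ⊢ A" := (derivable Ax G A) (at level 70).

Lemma cut1 (A B : formula) (G : list formula) :
  G ⊢ A -> [A] ⊢ B -> G ⊢ B.
Proof.
  intros HA HB; rewrite <- (app_nil_r G); exact (d_cut HA HB).
Qed.

Lemma bang_mono (A B : formula) : [A] ⊢ B -> [bang A] ⊢ bang B.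
Proof.
  intro H; exact (d_promotion (G := [A]) (d_dereliction H)).
Qed.

Lemma bang_elim (A : formula) : [bang A] ⊢ A.
Proof. apply d_dereliction, d_id. Qed.

Definition storable (A : formula) : Prop := [A] ⊢ bang A.

Lemma storable_bang (A : formula) : storable (bang A).
Proof. exact (d_promotion (G := [A]) (d_id Ax (bang A))). Qed.

(** [D] collects the formulas already treated, so that the induction on [G] always acts on the head
    of the context. *)
Lemma dereliction_context (G D : list formula) (C : formula) :
  G ++ D ⊢ C -> map bang G ++ D ⊢ C.
Proof.
  revert D; induction G as [| A G IH]; intros D H; simpl in *; [exact H |].
  apply d_dereliction.
  apply d_exchange with (map bang G ++ A :: D).
  - symmetry; apply Permutation_middle.
  - apply IH; apply d_exchange with (A :: G ++ D); [apply Permutation_middle | exact H].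
Qed.

Lemma storable_context (G D : list formula) (C : formula) :
  List.Forall storable G -> map bang G ++ D ⊢ C -> G ++ D ⊢ C.
Proof.
  intro HG; revert D; induction HG as [| A G HA HG IH]; intros D H; simpl in *;
    [exact H |].
  apply (d_cut (G := [A]) (D := G ++ D) HA).
  apply d_exchange with (G ++ bang A :: D).
  - symmetry; apply Permutation_middle.
  - apply IH; apply d_exchange with (bang A :: map bang G ++ D);
      [apply Permutation_middle | exact H].
Qed.

(** Dereliction bangs the whole context, promotion then applies, and cuts with [[B] ⊢ bang B] for
    each [B] in [G] remove the bangs again. *)
Lemma storable_promotion (G : list formula) (A : formula) :
  List.Forall storable G -> G ⊢ A -> G ⊢ bang A.
Proof.
  intros HG H; rewrite <- (app_nil_r G).
  apply storable_context; [exact HG |]; rewrite app_nil_r.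
  apply d_promotion; rewrite <- (app_nil_r (map bang G)).
  apply dereliction_context; rewrite app_nil_r; exact H.
Qed.

Lemma storable_tensor (A B : formula) :
  storable A -> storable B -> storable (A ⊗ B).
Proof.
  intros HA HB; apply d_tensor_l, storable_promotion.
  - auto.
  - exact (d_tensor_r (d_id Ax A) (d_id Ax B)).
Qed.

Lemma storable_plus (A B : formula) :
  storable A -> storable B -> storable (A ⊕ B).
Proof.
  intros HA HB; apply d_plus_l; apply storable_promotion;
    auto.
  - apply d_plus_r1, d_id.
  - apply d_plus_r2, d_id.
Qed.

Lemma ex_intro_shifted (A : formula) : [A] ⊢ shift (ex A).
Proof.
  apply d_ex_r with (Var 0); rewrite inst_Var0_subst_up_shift; apply d_id.
Qed.

Lemma all_elim_shifted (A : formula) : [shift (all A)] ⊢ A.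
Proof.
  apply d_all_l with (Var 0); rewrite inst_Var0_subst_up_shift; apply d_id.
Qed.

Lemma storable_ex (A : formula) : storable A -> storable (ex A).
Proof.
  intro HA; apply d_ex_l; apply storable_promotion.
  - auto.
  - apply ex_intro_shifted.
Qed.

(** Either [cbv A] starts with a bang, or its head is ⊗, ⊕ or ∃, which preserve storability. *)
Lemma storable_cbv (A : formula) : storable (cbv A).
Proof.
  induction A as [a | [] A IHA B IHB | [] A IHA]; simpl;
    auto using storable_bang, storable_tensor, storable_plus, storable_ex.
Qed.

Definition interderivable (A B : formula) : Prop := [A] ⊢ B /\ [B] ⊢ A.

Lemma interderivable_refl (A : formula) : interderivable A A.
Proof. split; apply d_id. Qed.

Lemma interderivable_sym (A B : formula) :
  interderivable A B -> interderivable B A.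
Proof. intros [H1 H2]; split; assumption. Qed.

Lemma interderivable_trans (A B C : formula) :
  interderivable A B -> interderivable B C -> interderivable A C.
Proof. intros [H1 H2] [H3 H4]; split; eapply cut1; eassumption. Qed.

Lemma interderivable_equivalent (A B : formula) :
  interderivable A B -> equivalent (derivable Ax) A B.
Proof.
  intros [H1 H2]; apply d_with_r; apply d_lolli_r; assumption.
Qed.

Lemma storable_interderivable (A : formula) :
  storable A -> interderivable (bang A) A.
Proof. split; [apply bang_elim | assumption]. Qed.

(** Both directions are assumed because ⊸ is contravariant on the left. *)
Lemma bin_mono (c : binop) (A A' B B' : formula) :
  interderivable A A' -> interderivable B B' -> [Bin c A B] ⊢ Bin c A' B'.
Proof.
  intros [HA HA'] [HB HB']; destruct c.
  - apply d_tensor_l; exact (d_tensor_r HA HB).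
  - apply d_with_r; [apply d_with_l1 | apply d_with_l2]; assumption.
  - apply d_plus_l; [apply d_plus_r1 | apply d_plus_r2]; assumption.
  - apply d_lolli_r; apply d_exchange with [A ⊸ B; A']; [apply perm_swap |].
    exact (d_lolli_l HA' HB).
Qed.

Lemma un_mono (q : unop) (A A' : formula) : [A] ⊢ A' -> [Un q A] ⊢ Un q A'.
Proof.
  intro H; destruct q.
  - apply d_all_r; exact (cut1 (all_elim_shifted A) H).
  - apply d_ex_l; exact (cut1 H (ex_intro_shifted A')).
  - apply bang_mono; exact H.
Qed.

Lemma interderivable_bin (c : binop) (A A' B B' : formula) :
  interderivable A A' -> interderivable B B' ->
  interderivable (Bin c A B) (Bin c A' B').
Proof.
  intros HA HB; split; apply bin_mono; auto using interderivable_sym.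
Qed.

Lemma interderivable_un (q : unop) (A A' : formula) :
  interderivable A A' -> interderivable (Un q A) (Un q A').
Proof. intros [H H']; split; apply un_mono; assumption. Qed.

(** By congruence the parts become call-by-value translations under one outer bang; [cbv] either
    keeps that bang or drops it from a storable formula. *)
Lemma interderivable_Gfo_cbv (A : formula) : interderivable (Gfo A) (cbv A).
Proof.
  induction A as [a | c A IHA B IHB | q A IHA]; simpl.
  - apply interderivable_refl.
  - apply interderivable_trans with (bang (Bin c (cbv A) (cbv B))).
    + apply interderivable_un, interderivable_bin; assumption.
    + pose proof (storable_cbv A); pose proof (storable_cbv B).
      destruct c; auto using interderivable_refl, storable_interderivable,
        storable_tensor, storable_plus.
  - apply interderivable_trans with (bang (Un q (cbv A))).
    + apply interderivable_un, interderivable_un; assumption.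
    + pose proof (storable_cbv A).
      destruct q; auto using interderivable_refl, storable_interderivable,
        storable_ex, storable_bang.
Qed.

Lemma interderivable_girard_reduction (X Y : formula) :
  girard_reduction X Y -> interderivable X Y.
Proof.
  intros []; auto using storable_interderivable, storable_bang, storable_tensor,
    storable_plus, storable_ex.
Qed.

End Derivations.

(** * Soundness of both translations from [ILb] to [ILL] *)

Section Soundness.

Variable Sg : signature.

Local Notation formula := (formula Sg).

Lemma interderivable_cbv (A : formula) : interderivable (@PRO Sg) A (cbv A).
Proof.
  (* Under [PRO] every formula is storable, so the bangs inserted by [cbv] change nothing up to
     equivalence. *)
  assert (Hb : forall B : formula, interderivable (@PRO Sg) B (bang B)).
  { intro B; apply interderivable_sym, storable_interderivable, d_ax; constructor. }
  assert (Hbang : forall B C : formula,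
    interderivable (@PRO Sg) B C -> interderivable (@PRO Sg) B (bang C)).
  { intros B C H; exact (interderivable_trans H (Hb C)). }
  induction A as [a | [] A IHA B IHB | [] A IHA]; simpl;
    auto using interderivable_bin, interderivable_un.
Qed.

(** Induction on derivations, one case per rule. Where [cbv] adds a bang, right rules are followed
    by promotion over the storable context and left rules by dereliction. *)
Lemma cbv_sequent_sound (G : list formula) (C : formula) :
  ILb G C -> ILL (map (@cbv Sg) G) (cbv C).
Proof.
  assert (HS : forall G' : list formula,
    List.Forall (storable (fun _ _ => False)) (map (@cbv Sg) G')).
  { intro G'; apply Forall_map, Forall_forall; intros A _; apply storable_cbv. }
  unfold ILb, ILL; intro H; induction H; simpl in *; rewrite ?map_app in *.
  - destruct H as [A]; apply storable_cbv.
  - eapply d_exchange; [apply Permutation_map; eassumption | assumption].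
  - apply d_id.
  - exact (d_promotion (G := []) (d_one_r _)).
  - apply storable_promotion; [apply HS | apply d_top_r].
  - apply d_dereliction, d_zero_l.
  - eapply d_cut; eassumption.
  - apply d_weakening; assumption.
  - apply d_tensor_r; assumption.
  - apply d_tensor_l; assumption.
  - apply storable_promotion; [apply HS | apply d_lolli_r; assumption].
  - apply d_dereliction, d_lolli_l; assumption.
  - apply storable_promotion; [apply HS | apply d_with_r; assumption].
  - apply d_dereliction, d_with_l1; assumption.
  - apply d_dereliction, d_with_l2; assumption.
  - apply d_plus_r1; assumption.
  - apply d_plus_r2; assumption.
  - apply d_plus_l; assumption.
  - apply storable_promotion; [apply HS | apply d_all_r].
    rewrite <- map_cbv_shift; assumption.
  - apply d_dereliction, d_all_l with t.
    unfold inst in *; rewrite <- cbv_subst; assumption.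
  - apply d_ex_r with t; unfold inst in *; rewrite <- cbv_subst; assumption.
  - apply d_ex_l; rewrite <- map_cbv_shift.
    unfold shift at 2; rewrite <- cbv_subst; assumption.
  - apply d_contraction; assumption.
  - apply d_weakening; assumption.
  (* [cbv] commutes with bang, so the translated context is again banged and promotion applies
     directly. *)
  - rewrite map_map in *; simpl in *; rewrite <- (map_map (@cbv Sg) bang) in *.
    apply d_promotion; assumption.
  - apply d_dereliction; assumption.
Qed.

Lemma cbv_sound : sound (@ILb Sg) (@ILL Sg) (@cbv Sg).
Proof.
  split; intro A.
  - exact (@cbv_sequent_sound [] A).
  - apply interderivable_equivalent, interderivable_cbv.
Qed.

Lemma Gfo_sound : sound (@ILb Sg) (@ILL Sg) (@Gfo Sg).
Proof.
  split; intro A.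
  - intro H; apply cut1 with (cbv A); [exact (cbv_sequent_sound H) |].
    apply interderivable_Gfo_cbv.
  - apply interderivable_equivalent, interderivable_trans with (cbv A).
    + apply interderivable_cbv.
    + apply interderivable_sym, interderivable_Gfo_cbv.
Qed.

End Soundness.

(** * From [Gfo] to [cbv] by reductions from the outside *)

Section OutsideReduction.

Variable Sg : signature.

Local Notation formula := (formula Sg).

Definition full_transforms : outer_transforms :=
  OuterTransforms (fun _ => true) (fun _ => true).

Definition cbv_transforms : outer_transforms :=
  OuterTransforms
    (fun c => match c with With | Lolli => true | Tensor | Plus => false end)
    (fun q => match q with Forall => true | Exists | Bang => false end).

Lemma Gfo_bang (A : formula) : exists B, Gfo A = bang B.
Proof. destruct A; simpl; eauto. Qed.

Lemma cbv_modular : modular_outer bang cbv_transforms (@cbv Sg).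
Proof.
  split; [reflexivity | split].
  - intros [] A B; reflexivity.
  - intros [] A; reflexivity.
Qed.

Lemma Gfo_modular : modular_outer bang full_transforms (@Gfo Sg).
Proof. split; [reflexivity | split; reflexivity]. Qed.

Lemma cbv_simplification :
  simplification (@ILb Sg) (@ILL Sg) cbv_transforms (@cbv Sg)
    full_transforms (@Gfo Sg).
Proof.
  assert (Hs : simpler false true).
  { split; [reflexivity | intro H; discriminate (H eq_refl)]. }
  split; [| split; [| split]].
  - split; [apply Gfo_sound | split; [apply cbv_sound |]].
    intro A; apply interderivable_equivalent, interderivable_Gfo_cbv.
  - intros []; simpl; unfold identical_or_simpler; auto.
  - intros []; simpl; unfold identical_or_simpler; auto.
  - left; exists Tensor; exact Hs.
Qed.

Lemma Gfo_reduces_outside (A : formula) :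
  reduces_outside bang full_transforms cbv_transforms (Gfo A) (cbv A).
Proof.
  destruct cbv_modular as [_ [Hbin Hun]].
  induction A as [a | c A IHA B IHB | q A IHA].
  - apply ro_stop; intros Y H; inversion H.
  - rewrite Hbin; simpl Gfo.
    (* The redexes display their parts in the form [bang A0], a form every [Gfo] translation has. *)
    destruct (Gfo_bang A) as [A0 EA]; rewrite EA in *.
    destruct (Gfo_bang B) as [B0 EB]; rewrite EB in *.
    exact (ro_bin c IHA IHB).
  - rewrite Hun; simpl Gfo.
    destruct (Gfo_bang A) as [A0 EA]; rewrite EA in *.
    exact (ro_un q IHA).
Qed.

(** For ⊗, ⊕, ∃ and ! the reduction fires once and the pass moves inside the reduct; in particular
    the reduct [bang (bang A0)] is not itself tested again. For &, ⊸ and ∀ neither the outer bang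
    nor the formula below it is a redex, hence two skips. *)
Lemma Gfo_outside_pass (A : formula) :
  outside_pass (@girard_reduction Sg) (Gfo A) (cbv A).
Proof.
  induction A as [a | c A IHA B IHB | q A IHA]; simpl Gfo.
  - apply op_skip; [intros Y H; inversion H |].
    apply sp_un, op_skip; [intros Y H; inversion H | apply sp_at].
  - destruct (Gfo_bang A) as [A0 EA]; rewrite EA in *.
    destruct (Gfo_bang B) as [B0 EB]; rewrite EB in *.
    destruct c; simpl cbv;
      try (eapply op_reduce; [constructor | apply sp_bin; assumption]);
      (apply op_skip; [intros Y H; inversion H |]);
      (apply sp_un, op_skip; [intros Y H; inversion H |]);
      apply sp_bin; assumption.
  - destruct (Gfo_bang A) as [A0 EA]; rewrite EA in *.
    destruct q; simpl cbv;
      try (eapply op_reduce; [constructor | apply sp_un; assumption]);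
      (apply op_skip; [intros Y H; inversion H |]);
      (apply sp_un, op_skip; [intros Y H; inversion H |]);
      apply sp_un; assumption.
Qed.

End OutsideReduction.

Theorem proposition9 (Sg : signature) :
  simplification_from_outside (@Un Sg Bang) (@ILb Sg) (@ILL Sg) (@cbv Sg) (@Gfo Sg) /\
  (forall A : formula Sg, outside_pass (@girard_reduction Sg) (Gfo A) (cbv A)) /\
  (forall X Y : formula Sg, girard_reduction X Y -> equivalent (@ILL Sg) X Y).
Proof.
  split; [| split].
  - exists cbv_transforms, full_transforms.
    auto using cbv_modular, Gfo_modular, cbv_simplification, Gfo_reduces_outside.
  - apply Gfo_outside_pass.
  - intros X Y H; apply interderivable_equivalent.
    apply interderivable_girard_reduction; exact H.
Qed.
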